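(* Let $X\sim N(\theta,\sigma_X^2)$ and $Y\sim N(\theta,\sigma_Y^2)$ be independent (univariate), with $\theta\ge 0$ unknown and $\sigma_X^2,\sigma_Y^2>0$ known, and consider the problem of estimating the density of $Y$ on the basis of $X$ under $\alpha$-divergence loss $L_\alpha$ with $|\alpha|<1$. Let $\hat\theta_+(X)=\max\{X,0\}$, and for $c\ge1$ let $q_{\hat\theta_+,c}(\cdot;X)$ be the density of $N(\hat\theta_+(X),c^2\sigma_Y^2)$. Set $r=\sigma_X^2/\sigma_Y^2$, $\gamma_0(c)=2\sigma_Y^2\left(\frac{c^2(1-\alpha)+1+\alpha}{1-\alpha^2}\right)$, $\gamma_1(c)=\sqrt{\frac{\gamma_0(c)}{\gamma_0(c)+\sigma_X^2}}$, $A_1(c)=\sqrt{\frac{2c^{1-\alpha}}{c^2(1-\alpha)+1+\alpha}}$, and $A_2(c)=-1+A_1(c)(1+\gamma_1(c))$. Then $q_{\hat\theta_+,c}$ dominates the plug-in maximum likelihood density $q_{\hat\theta_+,1}$ (over the parameter space $[0,\infty)$) if and only if $1<c\le\kappa(\alpha,r)$, where $\kappa(\alpha,r)$ is the solution in $c\in(1,\infty)$ of $$A_2(c)=\left(1+\frac{r(1-\alpha^2)}{4}\right)^{-1/2}.$$ Moreover, for such $c$, the dominance is strict (i.e. the risk of $q_{\hat\theta_+,c}$ at $\theta$ is strictly smaller than that of $q_{\hat\theta_+,1}$) for $\theta>0$ or $1<c<\kappa(\alpha,r)$, with equality of the risks if and only if $\theta=0$ and $c=\kappa(\alpha,r)$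.
   Context: Let $q(\cdot|\theta)$ be the density of $N(\theta,\sigma_Y^2)$. For $|\alpha|<1$ let $h_\alpha(z)=\frac{4}{1-\alpha^2}\left(1-z^{(1+\alpha)/2}\right)$. The $\alpha$-divergence loss of a predictive density $\hat q(\cdot;x)$ is $L_\alpha(\theta,\hat q(\cdot;x))=\int_{\mathbb{R}}h_\alpha\!\left(\frac{\hat q(y;x)}{q(y|\theta)}\right)q(y|\theta)\,dy$, and its frequentist risk is $R_\alpha(\theta,\hat q)=\mathbb{E}_\theta[L_\alpha(\theta,\hat q(\cdot;X))]$, the expectation being over $X\sim N(\theta,\sigma_X^2)$. A predictive density $\hat q_1$ dominates $\hat q_2$ if $R_\alpha(\theta,\hat q_1)\le R_\alpha(\theta,\hat q_2)$ for all $\theta$ in the parameter space, with strict inequality for at least one such $\theta$.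
   Formalization: The solution in (1,∞) is proved to exist, but its uniqueness is assumed for the dominance claims: for α=−0.9, r=210526 the equation has three solutions and the set of dominating c is not an interval (1,κ], so the claim fails there for every κ. *)

(* Defs.v *)
(* MathComp-Analysis. *)
From mathcomp Require Import all_boot all_order all_algebra.
From mathcomp Require Import all_classical all_reals all_analysis.

Set Implicit Arguments.
Unset Strict Implicit.
Unset Printing Implicit Defensive.

Import Order.TTheory GRing.Theory Num.Theory.
Import numFieldNormedType.Exports.

Local Open Scope classical_set_scope.
Local Open Scope ring_scope.

(* Throughout, [sX] and [sY] are the standard deviations of X and Y, in
   accordance with [normal_pdf] and [normal_prob]. *)

Section AlphaDivergence.
Context {R : realType}.
Implicit Types (alpha sX sY theta x y z : R).

Definition h_alpha alpha z : R :=
  4 / (1 - alpha ^+ 2) * (1 - z `^ ((1 + alpha) / 2)).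

(* The integral is extended-real valued, as a general [q] need not make it
   finite. *)
Definition alpha_loss alpha sY theta (q : R -> R) : \bar R :=
  (\int[lebesgue_measure]_y
     (h_alpha alpha (q y / normal_pdf theta sY y)
        * normal_pdf theta sY y)%:E)%E.

(* A predictive density is a map [qhat] with [qhat x] the estimated density
   when X = x is observed. *)
Definition alpha_risk alpha sX sY theta (qhat : R -> R -> R) : \bar R :=
  (\int[normal_prob theta sX]_x alpha_loss alpha sY theta (qhat x))%E.

Definition dominates alpha sX sY (Theta : set R) (q1 q2 : R -> R -> R) : Prop :=
  (forall theta, Theta theta ->
     (alpha_risk alpha sX sY theta q1 <= alpha_risk alpha sX sY theta q2)%E) /\
  (exists2 theta, Theta theta &
     (alpha_risk alpha sX sY theta q1 < alpha_risk alpha sX sY theta q2)%E).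

Definition theta_plus x : R := Num.max x 0.

Definition q_plus sY (c : R) x y : R := normal_pdf (theta_plus x) (c * sY) y.

End AlphaDivergence.

Section Constants.
Context {R : realType}.
Implicit Types (alpha sX sY c : R).

Definition ratio_r sX sY : R := sX ^+ 2 / sY ^+ 2.

Definition gamma0 alpha sY c : R :=
  2 * sY ^+ 2 * ((c ^+ 2 * (1 - alpha) + 1 + alpha) / (1 - alpha ^+ 2)).

Definition gamma1 alpha sX sY c : R :=
  Num.sqrt (gamma0 alpha sY c / (gamma0 alpha sY c + sX ^+ 2)).

Definition A1 alpha c : R :=
  Num.sqrt (2 * c `^ (1 - alpha) / (c ^+ 2 * (1 - alpha) + 1 + alpha)).

Definition A2 alpha sX sY c : R :=
  - 1 + A1 alpha c * (1 + gamma1 alpha sX sY c).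

Definition kappa_eq alpha sX sY c : Prop :=
  A2 alpha sX sY c =
    (1 + ratio_r sX sY * (1 - alpha ^+ 2) / 4) `^ (- (1 / 2)).

(* "kappa is the solution in (1, +oo)": a solution, and the only one.
   Uniqueness can fail: for alpha = -9/10 and
   sX ^+ 2 / sY ^+ 2 = 210526 the equation has three solutions,
   c = 1.31, c = 11.8 and c = 1.44e6 approximately. *)
Definition is_kappa alpha sX sY (kappa : R) : Prop :=
  [/\ 1 < kappa, kappa_eq alpha sX sY kappa &
      forall c, 1 < c -> kappa_eq alpha sX sY c -> c = kappa].

End Constants.

(* Main.v *)
Require Import Defs.
From mathcomp Require Import all_boot all_order all_algebra.
From mathcomp Require Import all_classical all_reals all_analysis.
From mathcomp Require Import measurable_realfun.
From mathcomp Require Import ring lra.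
Import Order.TTheory GRing.Theory Num.Theory.
Import numFieldNormedType.Exports.

Set Implicit Arguments.
Unset Strict Implicit.
Unset Printing Implicit Defensive.

Local Open Scope classical_set_scope.
Local Open Scope ring_scope.

(** Write e = (1 + alpha) / 2 and d = (1 - alpha) / 2, so that e + d = 1. The
    loss of N(m, c^2 sY^2) at theta involves the integral over y of the
    geometric mixture qhat^e q^d of two normal densities. Completing the square
    turns it into A1(c) exp(- (m - theta)^2 / (2 gamma0(c))) times a normal
    density ([geometric_mixture_normal_pdf]), hence the loss is
    K (1 - A1(c) exp(- (m - theta)^2 / (2 gamma0(c)))) with
    K = 4 / (1 - alpha^2).

    Put X = theta + Z with Z ~ N(0, sX^2). As max(X, 0) - theta =
    max(Z, - theta), the risk is K (1 - A1(c) E exp(- a max(Z, - theta)^2)) with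
    a = 1 / (2 gamma0(c)) ([alpha_risk_plus]). Let b be the value of a for the
    plug-in density c = 1, where A1(1) = 1; for c > 1 we have 0 < a < b. The
    risk improvement is thus K times Delta(theta) = E F(max(Z, - theta)) where
    F(x) = A1(c) exp(- a x^2) - exp(- b x^2).

    The heart of the proof is that F, as a function of x^2, first increases
    and then decreases ([expR_diff_unimodal]). So for each theta > 0 one of two
    pointwise comparisons of integrands applies ([kern_diff_truncation] and
    [lt_kern_mean]):
    - if F decreases on [theta, +oo), removing the truncation at - theta only
      lowers F, and Delta(theta) >= E F(Z), which is positive as soon as
      Delta(0) >= 0;
    - if F increases on [0, theta], truncating at 0 instead of - theta lowers
      F, strictly when Z < 0, and Delta(theta) > Delta(0).
    Everything is therefore decided at theta = 0. There the symmetry of Z gives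
    E exp(- a max(Z, 0)^2) = (1 + gamma1(c)) / 2 ([Rintegral_kern_pos]), and
    Delta(0) has the sign of A2(c) - gamma1(1), where gamma1(1) is the
    right-hand side of the equation that defines kappa ([kappa_eqE]).

    Finally A2 exceeds gamma1(1) immediately to the right of c = 1, since A1
    loses only a term of second order in c - 1 whereas gamma1 gains one of first
    order ([A2_near]), and A2 falls below gamma1(1) for large c, since A1 tends
    to 0 ([A2_far]). The intermediate value theorem yields a solution kappa;
    when it is the only one, it also yields A2 > gamma1(1) on (1, kappa) and
    A2 < gamma1(1) on (kappa, +oo). *)

(** * Transport of normal expectations *)

Section normal_prob_transport.
Context {R : realType}.
Local Notation mu := (@lebesgue_measure R).

Lemma measurable_shift (t : R) :
  measurable_fun setT (shift t : measurableTypeR R -> measurableTypeR R).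
Proof. exact: measurable_funD. Qed.

Lemma lebesgue_measure_shift (t : R) (A : set R) : measurable A ->
  pushforward mu (shift t : _ -> measurableTypeR R) A = mu A.
Proof.
move=> mA; apply/esym/lebesgue_measure_unique => //=.
  exact: measurable_shift.
move=> _ _ [[a b]] _ <-.
rewrite /pushforward.
have -> : shift t @^-1` `]a, b]%classic = `]a - t, b - t]%classic :> set R.
  by apply/seteqP; split => x /=; rewrite !in_itv/= ltrBlDr lerBrDr.
rewrite /= !lebesgue_measure_itv/= !lte_fin ltrD2r.
by case: ifP => // _; rewrite -!EFinD; congr EFin; ring.
Qed.

(** A change of variable that preserves Lebesgue measure and carries one normal
    density to another carries the normal laws to each other. The lemma serves
    the two such changes used below: centering and reflection. *)
Lemma normal_prob_pushforward (m s m' s' : R)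
    (phi : measurableTypeR R -> measurableTypeR R) :
  measurable_fun setT phi ->
  (forall A, measurable A -> pushforward mu phi A = mu A) ->
  normal_pdf m' s' \o phi =1 normal_pdf m s ->
  forall A, measurable A ->
    normal_prob m' s' A = pushforward (normal_prob m s) phi A.
Proof.
move=> mphi phimu phipdf A mA; rewrite /pushforward /normal_prob.
under [RHS]eq_integral do rewrite -phipdf.
transitivity (\int[pushforward mu phi]_(x in A) (normal_pdf m' s' x)%:E)%E.
  by apply: eq_measure_integral => // B mB _; exact/esym/phimu.
rewrite ge0_integral_pushforward//.
- apply/measurable_EFinP; apply: measurable_funTS; exact: measurable_normal_pdf.
- by move=> x _; rewrite lee_fin normal_pdf_ge0.
Qed.

Lemma ge0_integral_normal_prob_pushforward (m s m' s' : R)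
    (phi : measurableTypeR R -> measurableTypeR R) (f : R -> R) :
  measurable_fun setT phi ->
  (forall A, measurable A -> pushforward mu phi A = mu A) ->
  normal_pdf m' s' \o phi =1 normal_pdf m s ->
  measurable_fun setT f -> (forall x, 0 <= f x) ->
  (\int[normal_prob m' s']_x (f x)%:E = \int[normal_prob m s]_x (f (phi x))%:E)%E.
Proof.
move=> mphi phimu phipdf mf f0.
transitivity (\int[pushforward (normal_prob m s) phi]_x (f x)%:E)%E.
  apply: eq_measure_integral => B mB _.
  exact: (normal_prob_pushforward mphi phimu phipdf mB).
rewrite ge0_integral_pushforward//.
- exact/measurable_EFinP.
- by move=> x _; rewrite lee_fin.
Qed.

Lemma ge0_integral_normal_prob_center (m s : R) (f : R -> R) :
  0 < s -> measurable_fun setT f -> (forall x, 0 <= f x) ->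
  (\int[normal_prob m s]_x (f x)%:E
   = \int[normal_prob 0 s]_x (f (x + m)%R)%:E)%E.
Proof.
move=> s0 mf f0.
apply: (@ge0_integral_normal_prob_pushforward 0 s m s (shift m) f) => //.
- exact: measurable_shift.
- exact: lebesgue_measure_shift.
- move=> x /=; rewrite !normal_pdfE ?gt_eqF//.
  by rewrite [in LHS]normal_fun_center /= addrK.
Qed.

Lemma ge0_integral_normal_probN (s : R) (f : R -> R) :
  0 < s -> measurable_fun setT f -> (forall x, 0 <= f x) ->
  (\int[normal_prob 0 s]_x (f x)%:E = \int[normal_prob 0 s]_x (f (- x)%R)%:E)%E.
Proof.
move=> s0 mf f0.
apply: (@ge0_integral_normal_prob_pushforward 0 s 0 s -%R f) => //.
- exact: lebesgue_measureN.
- by move=> x /=; rewrite !normal_pdfE ?gt_eqF// /normal_fun !subr0 sqrrN.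
Qed.

(** The normal density is a Radon-Nikodym derivative of the normal law, by
    uniqueness of the latter up to a null set. *)
Lemma integral_normal_prob (m s : R) (f : R -> \bar R) :
  (normal_prob m s).-integrable setT f ->
  (\int[normal_prob m s]_x f x =
   \int[mu]_x (f x * (normal_pdf m s x)%:E))%E.
Proof.
move=> intf.
have mf : measurable_fun setT f by exact: measurable_int intf.
have ac := normal_prob_dominates m s.
rewrite -(Radon_Nikodym_change_of_variables ac)//=.
apply: ae_eq_integral => //.
- exact: emeasurable_funM.
- by apply: emeasurable_funM => //; apply/measurable_EFinP;
    exact: measurable_normal_pdf.
- apply: ae_eqe_mul2l => /=; rewrite Radon_NikodymE//=.
  case: cid => /= h [h1 h2 h3]; apply: integral_ae_eq => //=.
  + by apply/measurable_EFinP; exact: measurable_normal_pdf.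
  + by move=> E _ mE; rewrite -h3.
Qed.

Lemma bounded_integrable_normal_prob (m s M : R) (f : R -> R) :
  measurable_fun setT f -> (forall x, `|f x| <= M) ->
  (normal_prob m s).-integrable setT (EFin \o f).
Proof.
move=> mf fM; apply: measurable_bounded_integrable => //.
  by apply: le_lt_trans (probability_le1 (normal_prob m s) _) _ => //; exact: ltry.
exists M; split => [|N MN x _]; first exact: num_real.
exact: le_trans (fM x) (ltW MN).
Qed.

End normal_prob_transport.

(** * Unimodality of a difference of exponentials *)

Section exponential_difference.
Context {R : realType}.
Implicit Types a b A t w : R.

(** Strict convexity of exp: a d is the point that divides the segment from 0
    to b d in the ratio a / b. The proof combines the tangent inequality at
    a d, taken at the two ends of that segment. *)
Lemma expR_lt_chord a b (d : R) : 0 < a -> a < b -> d != 0 ->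
  b * expR (a * d) < a * expR (b * d) + (b - a).
Proof.
move=> a0 ab d0; have b0 : 0 < b := lt_trans a0 ab.
have E0 := expR_gt0 (a * d).
have h1 : expR (a * d) * (1 + (b - a) * d) < expR (b * d).
  have -> : b * d = a * d + (b - a) * d by ring.
  by rewrite [in ltRHS]expRD ltr_pM2l// expR_gt1Dx// mulf_neq0// gt_eqF// subr_gt0.
have h2 : expR (a * d) * (1 - a * d) < 1.
  rewrite -ltr_pdivlMl// mulr1 -expRN.
  by rewrite expR_gt1Dx// oppr_eq0 mulf_neq0// gt_eqF.
have h3 := ltr_pM2l a0 (expR (a * d) * (1 + (b - a) * d)) (expR (b * d)).
have ba0 : 0 < b - a by rewrite subr_gt0.
have h4 := ltr_pM2l ba0 (expR (a * d) * (1 - a * d)) 1.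
move: h1 h2; rewrite -h3 -h4; lra.
Qed.

Let D A a b w := A * expR (- (a * w)) - expR (- (b * w)).

Let D_sub A a b w t : D A a b t - D A a b w = expR (- (b * t)) *
  (A * expR ((b - a) * t) * (1 - expR (a * (t - w))) + expR (b * (t - w)) - 1).
Proof.
have e1 : expR (- (a * t)) = expR (- (b * t)) * expR ((b - a) * t).
  by rewrite -expRD; congr expR; ring.
have e2 : expR (- (a * w)) = expR (- (a * t)) * expR (a * (t - w)).
  by rewrite -expRD; congr expR; ring.
have e3 : expR (- (b * w)) = expR (- (b * t)) * expR (b * (t - w)).
  by rewrite -expRD; congr expR; ring.
rewrite /D e2 e3 e1; ring.
Qed.

(* By [expR_lt_chord], exp (b (t - w)) - 1 exceeds b / a times
   exp (a (t - w)) - 1, so the sign of the first factor below, which is that of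
   the derivative of D at t, settles the comparison. *)
Let D_lt A a b w t : 0 < a -> a < b -> w != t ->
  0 <= (b - a * (A * expR ((b - a) * t))) * (expR (a * (t - w)) - 1) ->
  D A a b w < D A a b t.
Proof.
move=> a0 ab wt; rewrite -[D A a b w < _]subr_gt0 D_sub pmulr_rgt0 ?expR_gt0//.
have d0 : t - w != 0 by rewrite subr_eq0 eq_sym.
have := expR_lt_chord a0 ab d0; set k := A * _; set x := expR _; set y := expR _.
move=> h1 h2; rewrite -(pmulr_rgt0 _ a0).
nra.
Qed.

(** At t, either the derivative of A exp (- a w) - exp (- b w) is nonpositive,
    and it remains so afterwards, or it is positive, and it was so before: its
    sign is that of b - a A exp ((b - a) w), which decreases with w. *)
Lemma expR_diff_unimodal A a b t : 0 < A -> 0 < a -> a < b ->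
  (forall w, t <= w ->
     A * expR (- (a * w)) - expR (- (b * w))
     <= A * expR (- (a * t)) - expR (- (b * t))) \/
  (forall v w, v < w -> w <= t ->
     A * expR (- (a * v)) - expR (- (b * v))
     < A * expR (- (a * w)) - expR (- (b * w))).
Proof.
move=> A0 a0 ab.
have ba0 : 0 < b - a by rewrite subr_gt0.
have [h|h] := leP b (a * (A * expR ((b - a) * t)));
  [left => w | right => v w vw wt].
  rewrite le_eqVlt => /predU1P[->//|tw]; apply/ltW/D_lt => //.
    by rewrite gt_eqF.
  rewrite -mulrNN mulr_ge0// oppr_ge0 subr_le0//.
  by rewrite expR_le1 pmulr_rle0// subr_le0 ltW.
apply: D_lt => //; first by rewrite lt_eqF.
apply: mulr_ge0; last first.
  rewrite subr_ge0 leNgt expR_lt1 -leNgt mulr_ge0 ?(ltW a0)// subr_ge0 ltW//.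
rewrite subr_ge0; apply: le_trans (ltW h).
by rewrite !ler_pM2l// ler_expR ler_pM2l.
Qed.

End exponential_difference.

(** * Expectations of Gaussian kernels *)

Section gaussian_kernel_expectation.
Context {R : realType}.
Implicit Types a b A s t x : R.
Local Notation mu := (@lebesgue_measure R).

Lemma normal_peak_scale k s : 0 < k -> 0 <= s ->
  normal_peak (k * s) = k^-1 * normal_peak s.
Proof.
move=> k0 s0; rewrite /normal_peak exprMn -mulrA -mulrnAr sqrtrM ?sqr_ge0//.
by rewrite sqrtr_sqr gtr0_norm// invfM.
Qed.

Lemma normal_prob_itv_gt0 m s u v : 0 < s -> u < v ->
  (0 < normal_prob m s `[u, v])%E.
Proof.
move=> s0 uv; rewrite /normal_prob.
(* On the interval, (x - m)^2 is at most its larger value at the endpoints. *)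
pose M := Num.max ((u - m) ^+ 2) ((v - m) ^+ 2).
pose e := normal_peak s * expR (- (M / (s ^+ 2 *+ 2))).
have e0 : 0 < e by rewrite mulr_gt0 ?expR_gt0// normal_peak_gt0// gt_eqF.
apply: (@lt_le_trans _ _ (\int[mu]_(x in `[u, v]) e%:E)%E).
  rewrite integral_cst//= lebesgue_measure_itv/= lte_fin uv -EFinD -EFinM lte_fin.
  by rewrite mulr_gt0// subr_gt0.
apply: ge0_le_integral => //.
- by move=> x _; rewrite lee_fin ltW.
- apply/measurable_EFinP; apply: measurable_funTS; exact: measurable_normal_pdf.
- move=> x /=; rewrite in_itv/= => /andP[ux xv].
  rewrite lee_fin normal_pdfE ?gt_eqF// /e ler_pM2l ?normal_peak_gt0 ?gt_eqF//.
  rewrite /normal_fun ler_expR mulNr lerN2 ler_pM2r; last first.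
    by rewrite invr_gt0 pmulrn_lgt0// exprn_gt0.
  rewrite /M le_max; have [xm|xm] := leP m x; apply/orP; [right|left]; nra.
Qed.

Definition kern a x := expR (- (a * x ^+ 2)).

Lemma measurable_kern a : measurable_fun setT (kern a).
Proof.
apply: measurableT_comp => //; apply: measurableT_comp => //.
by apply: measurable_funM => //; exact: measurable_funX.
Qed.

Lemma kern_ge0 a x : 0 <= kern a x. Proof. exact: expR_ge0. Qed.

Lemma kern_le1 a x : 0 <= a -> kern a x <= 1.
Proof. by move=> a0; rewrite expR_le1 oppr_le0 mulr_ge0// sqr_ge0. Qed.

Lemma kern0 a : kern a 0 = 1.
Proof. by rewrite /kern expr0n/= mulr0 oppr0 expR0. Qed.

Lemma integrable_kern m s a (f : R -> R) : 0 <= a -> measurable_fun setT f ->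
  (normal_prob m s).-integrable setT (EFin \o (kern a \o f)).
Proof.
move=> a0 mf; apply: (@bounded_integrable_normal_prob _ _ _ 1).
  by apply: measurableT_comp => //; exact: measurable_kern.
by move=> x /=; rewrite ger0_norm ?kern_ge0// kern_le1.
Qed.

(** The value of E exp (- a Z^2) for Z ~ N(0, s^2); it is also the ratio of the
    standard deviation of the law with density proportional to
    exp (- a z^2 - z^2 / (2 s^2)) to s. *)
Definition shrink s a := Num.sqrt (1 + 2 * a * s ^+ 2)^-1.

Lemma shrink_gt0 s a : 0 <= a -> 0 < shrink s a.
Proof.
move=> a0; rewrite sqrtr_gt0 invr_gt0 ltr_wpDr// mulr_ge0 ?sqr_ge0//.
by rewrite mulr_ge0.
Qed.

Lemma Rintegral_kern s a : 0 < s -> 0 <= a ->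
  \int[normal_prob 0 s]_z kern a z = shrink s a.
Proof.
move=> s0 a0; have k0 := shrink_gt0 s a0; set k := shrink s a in k0 *.
rewrite /Rintegral integral_normal_prob; last first.
  exact: (@integrable_kern _ _ _ id).
have kE : k ^- 2 = 1 + 2 * a * s ^+ 2.
  rewrite /k /shrink sqr_sqrtr ?invrK// invr_ge0 addr_ge0// mulr_ge0 ?sqr_ge0//.
  by rewrite mulr_ge0.
transitivity (fine (\int[mu]_z (k%:E * (normal_pdf 0 (k * s) z)%:E))%E).
  congr fine; apply: eq_integral => z _; rewrite -EFinM; congr EFin.
  rewrite !normal_pdfE ?gt_eqF ?mulr_gt0// normal_peak_scale ?(ltW s0)//.
  rewrite mulrCA -mulrA mulVKf ?gt_eqF//; congr *%R.
  rewrite /kern /normal_fun -expRD !subr0; congr expR.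
  have -> : - z ^+ 2 / ((k * s) ^+ 2 *+ 2) = k ^- 2 * (- z ^+ 2 / (s ^+ 2 *+ 2)).
    by field; rewrite !gt_eqF.
  by rewrite kE; field; rewrite gt_eqF.
rewrite integralZl//; last exact: integrable_normal_pdf.
by rewrite integral_normal_pdf mule1.
Qed.

Lemma measurable_max c : measurable_fun setT (fun z : R => Num.max z c).
Proof. exact: measurable_maxr. Qed.

(** Since Z and - Z have the same law, twice the left-hand side is the
    expectation of kern a (max Z 0) + kern a (max (- Z) 0), and this sum is
    1 + kern a Z because one of the two maxima is 0 and the other |Z|. *)
Lemma Rintegral_kern_pos s a : 0 < s -> 0 <= a ->
  \int[normal_prob 0 s]_z kern a (Num.max z 0) = (1 + shrink s a) / 2.
Proof.
move=> s0 a0.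
have I1 := @integrable_kern 0 s a _ a0 (measurable_max 0).
have mN : measurable_fun setT (fun z : R => Num.max (- z) 0).
  exact: measurable_maxr.
have I2 := @integrable_kern 0 s a _ a0 mN.
have I3 := @integrable_kern 0 s a id a0 (@measurable_id _ _ _).
have I4 : (normal_prob 0 s).-integrable setT (EFin \o cst (1 : R)).
  by apply: (@bounded_integrable_normal_prob _ _ _ 1) => // x; rewrite normr1.
pose J := \int[normal_prob 0 s]_z (kern a \o fun z => Num.max z 0) z.
pose J' := \int[normal_prob 0 s]_z (kern a \o fun z => Num.max (- z) 0) z.
pose K := \int[normal_prob 0 s]_z (kern a \o id) z.
pose C := \int[normal_prob 0 s]_z (cst (1 : R)) z.
have JJ' : J = J'.
  rewrite /J /Rintegral.
  rewrite (@ge0_integral_normal_probN _ s (kern a \o fun z => Num.max z 0))//.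
    apply: (measurableT_comp (measurable_kern a)); exact: measurable_max.
  by move=> x; exact: kern_ge0.
have K_eq : K = shrink s a by exact: Rintegral_kern.
have C_eq : C = 1.
  rewrite /C Rintegral_cst//.
  by rewrite [X in fine X](probability_setT (normal_prob 0 s)) mulr1.
have h : \int[normal_prob 0 s]_z ((kern a \o fun z => Num.max z 0) z +
                                 (kern a \o fun z => Num.max (- z) 0) z)
     = \int[normal_prob 0 s]_z (cst (1 : R) z + (kern a \o id) z).
  apply: eq_Rintegral => z _ /=.
  have [z0|z0] := leP 0 z.
  - have -> : Num.max (- z) 0 = 0 by apply/max_idPr; rewrite oppr_le0.
    by rewrite kern0 addrC.
  - have -> : Num.max (- z) 0 = - z by apply/max_idPl; rewrite oppr_ge0 ltW.
    by rewrite kern0 /kern sqrrN.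
have {h} : J + J' = C + K.
  by rewrite /J /J' /C /K -(RintegralD measurableT I1 I2)
    -(RintegralD measurableT I4 I3).
rewrite -JJ' K_eq C_eq => h; change (J = (1 + shrink s a) / 2); lra.
Qed.

End gaussian_kernel_expectation.

(** * Domination is decided at the boundary *)

Section risk_comparison.
Context {R : realType}.
Implicit Types a b A s t x : R.

(** For Z ~ N(0, s^2), the random variable max (Z, - t) is the estimation error
    of the truncated estimator when the parameter is t. *)
Definition kern_mean s a t : R :=
  \int[normal_prob 0 s]_z kern a (Num.max z (- t)).

Lemma kern_mean0 s a : 0 < s -> 0 <= a -> kern_mean s a 0 = (1 + shrink s a) / 2.
Proof. by move=> s0 a0; rewrite /kern_mean oppr0 Rintegral_kern_pos. Qed.

Lemma Rintegral_kern_diff A a b s (f : R -> R) :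
  0 <= a -> 0 <= b -> measurable_fun setT f ->
  (normal_prob 0 s).-integrable setT
    (EFin \o (fun z => A * kern a (f z) - kern b (f z))) /\
  \int[normal_prob 0 s]_z (A * kern a (f z) - kern b (f z)) =
  A * (\int[normal_prob 0 s]_z kern a (f z))
  - \int[normal_prob 0 s]_z kern b (f z).
Proof.
move=> a0 b0 mf.
have Ia := @integrable_kern R 0 s a f a0 mf.
have Ib := @integrable_kern R 0 s b f b0 mf.
have IA := @integrableZl _ _ _ _ _ measurableT A _ Ia.
split; first exact: (integrableB measurableT IA Ib).
have := @RintegralB _ _ _ (normal_prob 0 s) setT (fun z => A * kern a (f z))
   (kern b \o f) measurableT IA Ib.
move=> /= ->; congr (_ - _).
exact: (RintegralZl A measurableT Ia).
Qed.

Lemma shrink_lt s a b : 0 < s -> 0 < a -> a < b -> shrink s b < shrink s a.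
Proof.
move=> s0 a0 ab; have b0 : 0 < b := lt_trans a0 ab.
have p x : 0 < x -> 0 < 1 + 2 * x * s ^+ 2.
  by move=> x0; rewrite ltr_wpDr// !mulr_ge0 ?sqr_ge0// ltW.
rewrite ltr_sqrt ?invr_gt0 ?p// ltf_pV2 ?posrE ?p// ltrD2l.
by rewrite ltr_pM2r ?exprn_gt0// ltr_pM2l.
Qed.

(** The difference of kernels F is unimodal in |x|, so that |x| = t lies on its
    decreasing part, and then truncating at - t can only increase F, or on its
    increasing part, and then truncating at - t instead of 0 can only increase
    F. The interval in the second case has positive measure: this is what
    makes an inequality between expectations strict. *)
Lemma kern_diff_truncation A a b t (F := fun x => A * kern a x - kern b x) :
  0 < A -> 0 < a -> a < b -> 0 < t ->
  (forall z, F z <= F (Num.max z (- t))) \/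
  (F 0 < F (- t) /\ forall z,
     F (Num.max z 0) + (F (- t) - F 0) * \1_(`[- t - 1, - t]%classic) z
     <= F (Num.max z (- t))).
Proof.
move=> A0 a0 ab t0.
have [hdec|hinc] := @expR_diff_unimodal _ A _ _ (t ^+ 2) A0 a0 ab.
  left=> z; have [//|zt] := leP (- t) z.
  by rewrite /F /kern sqrrN; apply: hdec; nra.
have F0 : F 0 < F (- t).
  rewrite /F /kern sqrrN; apply: hinc => //.
  by rewrite expr0n/= exprn_gt0.
right; split=> // z; rewrite indicE.
have [tz|zt] := ltP (- t) z; last first.
  have -> : Num.max z 0 = 0 by apply/max_idPr; lra.
  move: F0; case: (_ \in _) => /=; lra.
rewrite memNset ?mulr0 ?addr0/=; last by rewrite in_itv/=; lra.
have [//|z0] := leP 0 z.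
rewrite /F /kern; apply/ltW/hinc; last by nra.
by rewrite expr0n/= exprn_even_gt0//= lt_eqF.
Qed.

(** The hypothesis on A says that the conclusion holds at t = 0 in the weak
    sense. *)
Lemma lt_kern_mean A a b s t :
  0 < s -> 0 < A -> 0 < a -> a < b ->
  1 + shrink s b <= A * (1 + shrink s a) -> 0 < t ->
  kern_mean s b t < A * kern_mean s a t.
Proof.
move=> s0 A0 a0 ab hA t0.
have a0' := ltW a0; have b0' : 0 <= b := ltW (lt_trans a0 ab).
have pos_untruncated : 0 < A * shrink s a - shrink s b.
  have sa0 := shrink_gt0 s a0'; have sab := shrink_lt s0 a0 ab.
  (* For A < 1, the hypothesis gives A * shrink s a - shrink s b >= 1 - A. *)
  rewrite subr_gt0; have [A1|A1] := leP 1 A; [nra|lra].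
have ge0_boundary :
    0 <= A * ((1 + shrink s a) / 2) - (1 + shrink s b) / 2 by lra.
have tt : - t - 1 < - t by lra.
pose F x := A * kern a x - kern b x.
have [It Et] := @Rintegral_kern_diff A a b s _ a0' b0' (measurable_max (- t)).
rewrite -subr_gt0 -[_ - _]Et.
have [hF|[F0 hF]] := kern_diff_truncation A0 a0 ab t0.
  have [I E] := @Rintegral_kern_diff A a b s id a0' b0' (@measurable_id _ _ _).
  apply: (@lt_le_trans _ _ (\int[normal_prob 0 s]_z F z)).
    by rewrite [ltRHS]E [in ltRHS]/= !Rintegral_kern.
  by apply: le_Rintegral => // z _; exact: hF.
have [I E] := @Rintegral_kern_diff A a b s _ a0' b0' (measurable_max 0).
pose B : set R := `[- t - 1, - t]%classic.
have mB : measurable B by exact: measurable_itv.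
pose e := F (- t) - F 0.
have e0 : 0 < e by rewrite subr_gt0.
have IB : (normal_prob 0 s).-integrable setT (EFin \o (fun z => e * \1_B z)).
  apply: (@bounded_integrable_normal_prob _ _ _ e).
    by apply: measurable_funM => //; exact: measurable_indic.
  move=> x; rewrite normrM gtr0_norm// ger_pMr// indicE.
  by case: (_ \in _); rewrite ?normr0 ?normr1.
have ID := integrableD measurableT I IB.
have EB : \int[normal_prob 0 s]_z (e * \1_B z) = e * fine (normal_prob 0 s B).
  rewrite RintegralZl//; last first.
    apply: (@bounded_integrable_normal_prob _ _ _ 1) => [|x].
      exact: measurable_indic.
    by rewrite indicE; case: (_ \in _); rewrite ?normr0 ?normr1.
  by congr *%R; rewrite /Rintegral integral_indic// setIT.
have PB : 0 < fine (normal_prob 0 s B).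
  have PB0 : (0 < normal_prob 0 s B)%E := normal_prob_itv_gt0 0 s0 tt.
  rewrite fine_gt0// PB0/=.
  by apply: le_lt_trans (probability_le1 (normal_prob 0 s) mB) _; exact: ltry.
apply: (@lt_le_trans _ _
    (\int[normal_prob 0 s]_z (F (Num.max z 0) + e * \1_B z))).
  have -> := RintegralD measurableT I IB.
  rewrite EB E !Rintegral_kern_pos//.
  by rewrite ltr_wpDl// mulr_gt0.
by apply: le_Rintegral => // z _; exact: hF.
Qed.

End risk_comparison.

(** * The risk in closed form *)

Section alpha_divergence_risk.
Context {R : realType}.
Implicit Types alpha sX sY c m theta y : R.

(** The precision of the geometric mixture of N(m, c^2 sY^2) and
    N(theta, sY^2) with weights (1 + alpha) / 2 and (1 - alpha) / 2 is
    spread alpha c / (c^2 sY^2). *)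
Definition spread alpha c : R := (1 + alpha) / 2 + (1 - alpha) / 2 * c ^+ 2.

Lemma spread1 alpha : spread alpha 1 = 1.
Proof. by rewrite /spread expr1n; field. Qed.

Lemma spread_gt0 alpha c : `|alpha| < 1 -> 0 < spread alpha c.
Proof.
rewrite ltr_norml => /andP[al0 al1].
by have := sqr_ge0 c; rewrite /spread; nra.
Qed.

Lemma spread_gt1 alpha c : `|alpha| < 1 -> 1 < c -> 1 < spread alpha c.
Proof.
rewrite ltr_norml => /andP[_ al1] c1.
have : 0 < (1 - alpha) * (c ^+ 2 - 1).
  by rewrite mulr_gt0 ?subr_gt0// exprn_egt1.
by rewrite /spread; lra.
Qed.

Lemma one_sub_sqr_gt0 alpha : `|alpha| < 1 -> 0 < 1 - alpha ^+ 2.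
Proof. by rewrite ltr_norml => /andP[al0 al1]; nra. Qed.

Lemma gamma0E alpha sY c : `|alpha| < 1 ->
  gamma0 alpha sY c = gamma0 alpha sY 1 * spread alpha c.
Proof.
move=> /one_sub_sqr_gt0 al; rewrite /gamma0 /spread expr1n; field.
by rewrite gt_eqF.
Qed.

Definition rate alpha sY c : R := (2 * gamma0 alpha sY c)^-1.

Lemma A1E alpha c : `|alpha| < 1 ->
  A1 alpha c = Num.sqrt (c `^ (1 - alpha) / spread alpha c).
Proof.
move=> al; rewrite /A1; congr Num.sqrt; have := spread_gt0 c al.
rewrite /spread => D0; field.
by rewrite !gt_eqF//; lra.
Qed.

Lemma A1_ge0 alpha c : 0 <= A1 alpha c. Proof. exact: sqrtr_ge0. Qed.

Lemma A1_gt0 alpha c : `|alpha| < 1 -> 0 < c -> 0 < A1 alpha c.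
Proof.
by move=> al c0; rewrite A1E// sqrtr_gt0 divr_gt0 ?powR_gt0 ?spread_gt0.
Qed.

Lemma A1_sqr alpha c : `|alpha| < 1 ->
  A1 alpha c ^+ 2 = c `^ (1 - alpha) / spread alpha c.
Proof.
by move=> al; rewrite A1E// sqr_sqrtr// divr_ge0 ?powR_ge0// ltW// spread_gt0.
Qed.

Lemma A1_1 alpha : `|alpha| < 1 -> A1 alpha 1 = 1.
Proof. by move=> al; rewrite A1E// spread1 powR1 divr1 sqrtr1. Qed.

(** A weighted geometric mean of two normal densities is an exponential of a
    quadratic polynomial in y. Completing the square leaves a normal density
    whose mean is the precision-weighted mean of m and theta; the constant in
    front is where A1 and gamma0 come from. *)
Lemma geometric_mixture_normal_pdf alpha sY theta m c :
  `|alpha| < 1 -> 0 < sY -> 0 < c ->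
  exists m' s', forall y,
  (normal_pdf m (c * sY) y / normal_pdf theta sY y) `^ ((1 + alpha) / 2)
    * normal_pdf theta sY y =
  A1 alpha c * kern (rate alpha sY c) (m - theta) * normal_pdf m' s' y.
Proof.
move=> al s0 c0.
pose D := spread alpha c.
exists (((1 + alpha) / 2 * m + (1 - alpha) / 2 * c ^+ 2 * theta) / D).
exists (c / Num.sqrt D * sY) => y.
have D0 : 0 < D by exact: spread_gt0.
have -> : A1 alpha c = c `^ ((1 - alpha) / 2) / Num.sqrt D.
  rewrite A1E// powRrM powR12_sqrt ?powR_ge0// -sqrtrV ?ltW//.
  by rewrite -sqrtrM ?powR_ge0.
move: al; rewrite ltr_norml => /andP[al0 al1].
have c2 : 0 < c ^+ 2 by rewrite exprn_gt0.
have sD0 : 0 < Num.sqrt D by rewrite sqrtr_gt0.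
have sDD : Num.sqrt D ^+ 2 = D by rewrite sqr_sqrtr// ltW.
have p0 : 0 < normal_peak sY by rewrite normal_peak_gt0// gt_eqF.
rewrite !normal_pdfE ?gt_eqF ?mulr_gt0 ?invr_gt0//.
rewrite !normal_peak_scale ?divr_gt0 ?(ltW s0)//.
set u := - (y - m) ^+ 2 / ((c * sY) ^+ 2 *+ 2).
set v := - (y - theta) ^+ 2 / (sY ^+ 2 *+ 2).
have -> : c^-1 * normal_peak sY * normal_fun m (c * sY) y /
    (normal_peak sY * normal_fun theta sY y) = c^-1 * expR (u - v).
  rewrite /normal_fun -/u -/v expRB; field.
  by rewrite !gt_eqF// expR_gt0.
rewrite powRM ?invr_ge0 ?(ltW c0) ?expR_ge0// -expRM.
have -> : c^-1 `^ ((1 + alpha) / 2) = c `^ ((1 - alpha) / 2) / c.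
  rewrite -[c^-1]powR_inv1 ?(ltW c0)// -powRrM -powRD ?(gt_eqF c0) ?implybT//.
  by congr powR; field.
set P := c `^ _; set E1 := expR _.
rewrite /normal_fun -/v.
set w := - (y - _) ^+ 2 / _.
have -> : P / Num.sqrt D * kern (rate alpha sY c) (m - theta) *
    ((c / Num.sqrt D)^-1 * normal_peak sY * expR w) =
    P / c * normal_peak sY * (kern (rate alpha sY c) (m - theta) * expR w).
  by field; rewrite !gt_eqF.
rewrite (_ : kern _ _ * _ = E1 * expR v); first by ring.
rewrite /kern /E1 -!expRD; congr expR.
have wE : w = - (y - ((1 + alpha) / 2 * m + (1 - alpha) / 2 * c ^+ 2 * theta) / D)
   ^+ 2 / (2 * (c ^+ 2 * sY ^+ 2 / D)).
  rewrite /w; congr (_ / _).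
  by rewrite -[X in _ = 2 * (_ / X)]sDD; field; rewrite gt_eqF.
rewrite wE /rate /gamma0 /u /v /D /spread.
have h1 : c ^+ 2 * (1 - alpha) + 1 + alpha != 0 by rewrite gt_eqF//; nra.
have h2 : 1 - alpha ^+ 2 != 0 by rewrite gt_eqF//; nra.
field; rewrite h2 !gt_eqF//=; nra.
Qed.

Lemma rate_gt0 alpha sY c : `|alpha| < 1 -> 0 < sY -> 0 < rate alpha sY c.
Proof.
rewrite ltr_norml => /andP[al0 al1] s0.
have c2 : 0 <= c ^+ 2 by rewrite sqr_ge0.
rewrite /rate /gamma0 invr_gt0 !pmulr_rgt0 ?exprn_gt0 ?invr_gt0//; nra.
Qed.

Lemma alpha_loss_normal alpha sY theta m c : `|alpha| < 1 -> 0 < sY -> 0 < c ->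
  alpha_loss alpha sY theta (normal_pdf m (c * sY)) =
  (4 / (1 - alpha ^+ 2) *
    (1 - A1 alpha c * kern (rate alpha sY c) (m - theta)))%:E.
Proof.
move=> al s0 c0; rewrite /alpha_loss /h_alpha.
have [m' [s' Ey]] := geometric_mixture_normal_pdf theta m al s0 c0.
set K := 4 / _; set G := A1 _ _ * kern _ _ in Ey *.
transitivity (\int[lebesgue_measure]_y (K%:E * (normal_pdf theta sY y)%:E
   - (K * G)%:E * (normal_pdf m' s' y)%:E))%E.
  apply: eq_integral => y _; rewrite -!EFinM -EFinB; congr EFin.
  by rewrite -(mulrA K G) -Ey; ring.
have I1 := @integrable_normal_pdf R theta sY.
have I2 := @integrable_normal_pdf R m' s'.
rewrite integralB//=; [|exact: integrableZl..].
rewrite !integralZl// !integral_normal_pdf !mule1 -EFinB; congr EFin; ring.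
Qed.

(** The loss depends on x only through max (x, 0) - theta, which is
    max (z, - theta) for x = z + theta. *)
Lemma alpha_risk_plus alpha sX sY theta c :
  `|alpha| < 1 -> 0 < sX -> 0 < sY -> 0 < c ->
  alpha_risk alpha sX sY theta (q_plus sY c) =
  (4 / (1 - alpha ^+ 2) *
    (1 - A1 alpha c * kern_mean sX (rate alpha sY c) theta))%:E.
Proof.
move=> al sX0 sY0 c0; rewrite /alpha_risk /q_plus.
under eq_integral do rewrite alpha_loss_normal//.
set K := 4 / _; set A := A1 _ _; set a := rate _ _ _.
have a0 : 0 <= a by rewrite ltW// rate_gt0.
pose f x := kern a (theta_plus x - theta).
have mf : measurable_fun setT (fun x : R => theta_plus x - theta).
  by apply: measurable_funB => //; exact: measurable_max.
have If := @integrable_kern R theta sX a _ a0 mf.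
have f_center : (\int[normal_prob theta sX]_x (f x)%:E
    = (kern_mean sX a theta)%:E)%E.
  rewrite (@ge0_integral_normal_prob_center _ theta sX f)//; last 2 first.
  - exact: (measurableT_comp (measurable_kern a)).
  - by move=> x; exact: kern_ge0.
  rewrite /kern_mean /Rintegral fineK; last first.
    apply: (@integrable_fin_num _ _ _ (normal_prob 0 sX)) => //.
    exact: integrable_kern (measurable_max _).
  apply: eq_integral => z _; congr (EFin (kern a _)).
  by rewrite /theta_plus addr_maxl addrK add0r.
transitivity (\int[normal_prob theta sX]_x (K%:E - (K * A)%:E * (f x)%:E))%E.
  apply: eq_integral => x _; rewrite -EFinM -EFinB; congr EFin; rewrite /f; ring.
have IK : (normal_prob theta sX).-integrable setT (fun=> K%:E).
  by apply: (@bounded_integrable_normal_prob _ _ _ `|K| (cst K)).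
rewrite integralB//=; last exact: integrableZl.
rewrite integralZl// f_center integral_cst//=.
rewrite [X in (_ * X)%E](probability_setT (normal_prob theta sX)) mule1.
by rewrite -EFinD; congr EFin; ring.
Qed.

End alpha_divergence_risk.

(** * The threshold equation *)

Section threshold.
Context {R : realType}.
Implicit Types alpha sX sY c : R.

Lemma gamma0_gt0 alpha sY c : `|alpha| < 1 -> 0 < sY -> 0 < gamma0 alpha sY c.
Proof.
move=> al s0; have := rate_gt0 c al s0.
by rewrite /rate invr_gt0 pmulr_rgt0.
Qed.

Lemma gamma1_le1 alpha sX sY c : `|alpha| < 1 -> 0 < sX -> 0 < sY ->
  gamma1 alpha sX sY c <= 1.
Proof.
move=> al sX0 s0; have gc := gamma0_gt0 c al s0.
rewrite /gamma1 -[leRHS]sqrtr1 ler_wsqrtr// ler_pdivrMr ?addr_gt0 ?exprn_gt0//.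
by rewrite mul1r lerDl ltW// exprn_gt0.
Qed.

Lemma gamma1_shrink alpha sX sY c : `|alpha| < 1 -> 0 < sY ->
  gamma1 alpha sX sY c = shrink sX (rate alpha sY c).
Proof.
move=> al s0; have g0 := gamma0_gt0 c al s0.
rewrite /gamma1 /shrink /rate; congr Num.sqrt; field.
by rewrite !gt_eqF// ltr_wpDr// sqr_ge0.
Qed.

Lemma kappa_eqE alpha sX sY c : `|alpha| < 1 -> 0 < sY ->
  kappa_eq alpha sX sY c <-> A2 alpha sX sY c = gamma1 alpha sX sY 1.
Proof.
move=> al s0; rewrite /kappa_eq.
suff -> : (1 + ratio_r sX sY * (1 - alpha ^+ 2) / 4) `^ (- (1 / 2)) =
  gamma1 alpha sX sY 1 by [].
have g0 := gamma0_gt0 1 al s0.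
have a0 := one_sub_sqr_gt0 al.
have r0 : 0 <= ratio_r sX sY * (1 - alpha ^+ 2) / 4.
  rewrite /ratio_r -expr_div_n divr_ge0// mulr_ge0 ?sqr_ge0//; exact: ltW.
rewrite powRN div1r powR12_sqrt ?addr_ge0// -sqrtrV ?addr_ge0//.
rewrite /gamma1; congr Num.sqrt.
move: g0 a0; rewrite /gamma0 /ratio_r => g0 a0.
field.
have s2 : 0 < sY ^+ 2 by rewrite exprn_gt0.
have x2 : 0 <= sX ^+ 2 * (1 - alpha ^+ 2) by rewrite mulr_ge0 ?sqr_ge0 ?ltW.
by rewrite !gt_eqF//; lra.
Qed.

Lemma continuous_A2 alpha sX sY c : `|alpha| < 1 -> 0 < sY -> 0 < c ->
  {for c, continuous (A2 alpha sX sY)}.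
Proof.
move=> al s0 c0.
have D0 : 0 < c ^+ 2 * (1 - alpha) + 1 + alpha.
  by have := spread_gt0 c al; rewrite /spread; lra.
have cD : {for c, continuous (fun x : R => x ^+ 2 * (1 - alpha) + 1 + alpha)}.
  apply: cvgD; last exact: cvg_cst.
  apply: cvgD; last exact: cvg_cst.
  apply: cvgM; last exact: cvg_cst.
  exact: sqr_continuous.
have cP : {for c, continuous (fun x : R => x `^ (1 - alpha))}.
  apply/differentiable_continuous/derivable1_diffP/derivable_powR.
  by rewrite in_itv/= c0.
have cG : {for c, continuous (gamma0 alpha sY)}.
  apply: cvgM; first exact: cvg_cst.
  by apply: cvgM => //; exact: cvg_cst.
have cA1 : {for c, continuous (A1 alpha)}.
  apply: (@continuous_comp _ _ _
    (fun x => 2 * x `^ (1 - alpha) / (x ^+ 2 * (1 - alpha) + 1 + alpha))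
    Num.sqrt); last exact: sqrt_continuous.
  apply: cvgM; first by apply: cvgM => //; exact: cvg_cst.
  by apply: cvgV => //; rewrite gt_eqF.
have cg1 : {for c, continuous (gamma1 alpha sX sY)}.
  apply: (@continuous_comp _ _ _
    (fun x => gamma0 alpha sY x / (gamma0 alpha sY x + sX ^+ 2))
    Num.sqrt); last exact: sqrt_continuous.
  apply: cvgM => //; apply: cvgV.
    by rewrite gt_eqF// ltr_wpDr ?sqr_ge0// gamma0_gt0.
  by apply: cvgD => //; exact: cvg_cst.
apply: cvgD; first exact: cvg_cst.
by apply: cvgM => //; apply: cvgD => //; exact: cvg_cst.
Qed.

Lemma A2_IVT alpha sX sY u v x : `|alpha| < 1 -> 0 < sY -> 0 < u -> u <= v ->
  A2 alpha sX sY v <= x <= A2 alpha sX sY u ->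
  exists2 c, u <= c <= v & A2 alpha sX sY c = x.
Proof.
move=> al s0 u0 uv /andP[vx xu].
have [||c] := @IVT _ (A2 alpha sX sY) u v x uv.
- apply: continuous_in_subspaceT => c; rewrite inE/= in_itv/= => /andP[uc cv].
  by apply: continuous_A2 => //; exact: lt_le_trans uc.
- by rewrite ge_min le_max vx xu orbT.
- by rewrite in_itv/=; exists c.
Qed.

(** A1(c)^2 is at most c^(1 - alpha) / (d c^2) with d = (1 - alpha) / 2, which
    is 1 / (d c^(1 + alpha)) and hence tends to 0. Once A1(c) <= 1 / 2, A2(c) is
    nonpositive. *)
Lemma A2_far alpha sX sY c : `|alpha| < 1 -> 0 < sX -> 0 < sY -> 1 < c ->
  exists2 c', c < c' & A2 alpha sX sY c' < gamma1 alpha sX sY 1.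
Proof.
move=> al sX0 s0 c1; have := al; rewrite ltr_norml => /andP[al0 al1].
pose d := (1 - alpha) / 2; have d0 : 0 < d by rewrite /d; lra.
pose p := 1 + alpha; have p0 : 0 < p by rewrite /p; lra.
pose c0 := (4 / d) `^ p^-1.
have c00 : 0 <= c0 by exact: powR_ge0.
exists (c + 1 + c0); first by lra.
set c' := c + 1 + c0.
have c'0 : 0 < c' by rewrite /c'; lra.
have hp : 4 / d <= c' `^ p.
  have -> : 4 / d = c0 `^ p.
    by rewrite -powRrM mulVf ?gt_eqF// powRr1// divr_ge0// ltW.
  by rewrite ge0_ler_powR ?nnegrE ?(ltW p0) ?(ltW c'0)// /c'; lra.
have hc : c' `^ (1 - alpha) * c' `^ p = c' ^+ 2.
  rewrite -powRD ?(gt_eqF c'0) ?implybT//.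
  have -> : 1 - alpha + p = 2%:R by rewrite /p; ring.
  by rewrite powR_mulrn// ltW.
have D0 := spread_gt0 c' al.
have hA : A1 alpha c' ^+ 2 <= 4^-1.
  rewrite A1_sqr// ler_pdivrMr// /spread -/d -hc.
  have P0 := powR_ge0 c' (1 - alpha).
  have h : 4 <= d * c' `^ p by rewrite mulrC -ler_pdivrMr.
  have := ler_wpM2l P0 h; lra.
have A0 := A1_ge0 alpha c'.
have hA' : A1 alpha c' <= 1 / 2 by rewrite leNgt; apply/negP => hn; nra.
have g1 := gamma1_le1 c' al sX0 s0.
have g'0 : 0 < gamma1 alpha sX sY 1.
  by rewrite gamma1_shrink// shrink_gt0// ltW// rate_gt0.
have g0 : 0 <= gamma1 alpha sX sY c' by exact: sqrtr_ge0.
rewrite /A2; nra.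
Qed.

(** A1 has a vanishing derivative at 1: to first order in e, c^(1 - alpha) and
    spread alpha c have the same expansion 1 + (1 - alpha) e at c = 1 + e. *)
Lemma A1_lower alpha e : `|alpha| < 1 -> 0 < e ->
  1 - 3 * e ^+ 2 <= A1 alpha (1 + e).
Proof.
move=> al e0; have := al; rewrite ltr_norml => /andP[al0 al1].
pose d := (1 - alpha) / 2.
have d0 : 0 < d by rewrite /d; lra.
have d1 : d < 1 by rewrite /d; lra.
have D0 := spread_gt0 (1 + e) al.
have ln_ge : 1 - (1 + e)^-1 <= ln (1 + e).
  have h : ln ((1 + e)^-1) <= (1 + e)^-1 - 1.
    rewrite -{1}[(1 + e)^-1](subrK 1) addrC; apply: le_ln1Dx.
    by rewrite ltrBrDl subrr invr_gt0; lra.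
  by move: h; rewrite lnV ?posrE; lra.
have P : 1 + 2 * d * (1 - (1 + e)^-1) <= (1 + e) `^ (1 - alpha).
  rewrite /powR gt_eqF; last by lra.
  apply: le_trans (expR_ge1Dx _).
  have -> : 1 - alpha = 2 * d by rewrite /d; field.
  by rewrite lerD2l ler_wpM2l// mulr_ge0// ltW.
have V : 1 - e <= (1 + e)^-1 by rewrite -[leRHS]mul1r ler_pdivlMr; nra.
have W : e - e ^+ 2 <= 1 - (1 + e)^-1.
  have -> : 1 - (1 + e)^-1 = e * (1 + e)^-1 by field; lra.
  nra.
have hA : 1 - 3 * e ^+ 2 <= A1 alpha (1 + e) ^+ 2.
  rewrite A1_sqr// ler_pdivlMr//; apply: le_trans P.
  apply: (@le_trans _ _ (1 + 2 * d * (e - e ^+ 2))); last first.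
    by rewrite lerD2l ler_wpM2l// mulr_ge0// ltW.
  have -> : spread alpha (1 + e) = 1 + d * (2 * e + e ^+ 2).
    by rewrite /spread /d; field.
  have t0 : 0 <= e ^+ 2 * (d * (2 * e + e ^+ 2)).
    rewrite mulr_ge0 ?sqr_ge0// mulr_ge0 ?(ltW d0)//.
    by have := sqr_ge0 e; lra.
  have t1 : d * e ^+ 2 <= e ^+ 2 by rewrite ler_piMl ?sqr_ge0// ltW.
  nra.
have A0 := A1_ge0 alpha (1 + e).
(* If A1 were below 1 - 3 e^2 < 1, then A1^2 <= A1 would be as well. *)
rewrite leNgt; apply/negP => hn; nra.
Qed.

(** gamma1(c)^2 = g / (g + sX^2) with g = gamma0(c), and gamma0 grows at least
    linearly to the right of 1. The squares pass to the values themselves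
    because gamma1 stays in [0, 1]. *)
Lemma gamma1_increment alpha sX sY : `|alpha| < 1 -> 0 < sX -> 0 < sY ->
  exists2 k, 0 < k & forall e, 0 < e <= 1 ->
    gamma1 alpha sX sY 1 + k * e <= gamma1 alpha sX sY (1 + e).
Proof.
move=> al sX0 s0; have := al; rewrite ltr_norml => /andP[al0 al1].
pose d := (1 - alpha) / 2.
have d0 : 0 < d by rewrite /d; lra.
have d1 : d < 1 by rewrite /d; lra.
have g0 := gamma0_gt0 1 al s0; set g := gamma0 alpha sY 1 in g0.
have t0 : 0 < sX ^+ 2 by rewrite exprn_gt0.
set t := sX ^+ 2 in t0.
have q0 : 0 < (4 * g + t) * (g + t) by rewrite mulr_gt0//; lra.
have tg0 : 0 < t * g by rewrite mulr_gt0.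
have td0 : 0 < t * g * d by rewrite mulr_gt0// mulr_gt0.
exists (t * g * d / ((4 * g + t) * (g + t))); first by rewrite divr_gt0.
move=> e /andP[e0 e1].
have D : spread alpha (1 + e) = 1 + d * (2 * e + e ^+ 2).
  by rewrite /spread /d; field.
(* The upper bound makes g * S + t at most 4 * g + t below. *)
have De : 2 * d * e <= spread alpha (1 + e) - 1 <= 3.
  rewrite D addrAC subrr add0r; apply/andP; split.
    by have := sqr_ge0 e; nra.
  nra.
have E1 : gamma1 alpha sX sY 1 ^+ 2 = g / (g + t).
  by rewrite /gamma1 sqr_sqrtr// divr_ge0 ?(ltW g0)// ltW// addr_gt0.
have G0 := gamma0_gt0 (1 + e) al s0.
have Ee : gamma1 alpha sX sY (1 + e) ^+ 2 =
    g * spread alpha (1 + e) / (g * spread alpha (1 + e) + t).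
  rewrite -gamma0E// /gamma1 sqr_sqrtr// divr_ge0 ?(ltW G0)// ltW// addr_gt0//.
set S := spread alpha (1 + e) in De Ee *.
have /andP[De1 De2] := De.
have S0 : 0 < g * S by rewrite mulr_gt0// spread_gt0.
have diff : gamma1 alpha sX sY 1 ^+ 2 +
    2 * (t * g * d / ((4 * g + t) * (g + t)) * e) <=
    gamma1 alpha sX sY (1 + e) ^+ 2.
  rewrite E1 Ee -lerBrDl.
  have -> : g * S / (g * S + t) - g / (g + t) =
      t * g * (S - 1) / ((g * S + t) * (g + t)).
    by field; rewrite !gt_eqF// addr_gt0.
  have -> : 2 * (t * g * d / ((4 * g + t) * (g + t)) * e) =
      t * g * (2 * d * e) / ((4 * g + t) * (g + t)).
    by field; rewrite !gt_eqF// ?addr_gt0// mulr_gt0.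
  apply: ler_pM.
  - rewrite mulr_ge0 ?(ltW tg0)// mulr_ge0 ?(ltW e0)// mulr_ge0// ltW//.
  - by rewrite invr_ge0 ltW.
  - by rewrite ler_pM2l.
  - have gt0 : 0 < g + t by exact: addr_gt0.
    have p0 : 0 < (g * S + t) * (g + t) by rewrite mulr_gt0 ?addr_gt0.
    rewrite lef_pV2 ?posrE// ler_pM2r// lerD2r mulrC ler_pM2r//; lra.
have y0 : 0 <= gamma1 alpha sX sY 1 by exact: sqrtr_ge0.
have x0 : 0 <= gamma1 alpha sX sY (1 + e) by exact: sqrtr_ge0.
have x1 := gamma1_le1 (1 + e) al sX0 s0.
have y1 := gamma1_le1 1 al sX0 s0.
set k := _ / _ * e in diff *.
have k0 : 0 < k by rewrite mulr_gt0// divr_gt0.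
set y := gamma1 _ _ _ 1 in diff y0 y1 *; set x := gamma1 _ _ _ _ in diff x0 x1 *.
rewrite leNgt; apply/negP => h.
have [xy|xy] := leP x y; first by nra.
have : (x - y) * (x + y) <= (x - y) * 2 by rewrite ler_pM2l ?subr_gt0//; lra.
lra.
Qed.

(** For c = 1 + e, the gain k e of gamma1 beats the loss of at most 6 e^2 caused
    by A1, as soon as 7 e <= k. *)
Lemma A2_near alpha sX sY c : `|alpha| < 1 -> 0 < sX -> 0 < sY -> 1 < c ->
  exists2 c', 1 < c' < c & gamma1 alpha sX sY 1 < A2 alpha sX sY c'.
Proof.
move=> al sX0 s0 c1; have [k k0 hk] := gamma1_increment al sX0 s0.
pose e := Num.min 1 (Num.min ((c - 1) / 2) (k / 7)).
have e0 : 0 < e by rewrite !lt_min ltr01/= !divr_gt0// subr_gt0.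
have e1 : e <= 1 by rewrite ge_min lexx.
have ec : e <= (c - 1) / 2 by rewrite !ge_min lexx !orbT.
have ek : e <= k / 7 by rewrite !ge_min lexx !orbT.
exists (1 + e); first by apply/andP; split; lra.
have hA := A1_lower al e0.
have he : 0 < e <= 1 by rewrite e0.
have hg := hk e he.
have x0 : 0 <= gamma1 alpha sX sY (1 + e) by exact: sqrtr_ge0.
have x1 := gamma1_le1 (1 + e) al sX0 s0.
rewrite /A2.
set y := gamma1 _ _ _ 1 in hg *; set x := gamma1 _ _ _ _ in hg x0 x1 *.
set A := A1 _ _ in hA *.
have h1 : (1 - 3 * e ^+ 2) * (1 + x) <= A * (1 + x).
  by rewrite ler_wpM2r// addr_ge0.
have h2 : e ^+ 2 * x <= e ^+ 2 by rewrite ler_piMr// sqr_ge0.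
have h3 : e ^+ 2 * 7 <= k * e by nra.
have h4 : 0 < e ^+ 2 by rewrite exprn_gt0.
lra.
Qed.

End threshold.

(** * Domination *)

Section domination.
Context {R : realType}.
Implicit Types alpha sX sY c theta : R.

Lemma exists_kappa alpha sX sY : `|alpha| < 1 -> 0 < sX -> 0 < sY ->
  exists2 c, 1 < c & kappa_eq alpha sX sY c.
Proof.
move=> al sX0 sY0.
have [u /andP[u1 _] hu] := A2_near al sX0 sY0 (ltr1n R 2).
have [v uv hv] := A2_far al sX0 sY0 u1.
have hx : A2 alpha sX sY v <= gamma1 alpha sX sY 1 <= A2 alpha sX sY u.
  by rewrite !ltW.
have [c /andP[uc _] hc] := A2_IVT al sY0 (lt_trans ltr01 u1) (ltW uv) hx.
by exists c; [exact: lt_le_trans uc | exact/kappa_eqE].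
Qed.

(** Otherwise A2 would take the value gamma1(1) between a point close to 1,
    where it is larger, and c: a second solution of the equation. *)
Lemma A2_lt_kappa alpha sX sY kappa c : `|alpha| < 1 -> 0 < sX -> 0 < sY ->
  is_kappa alpha sX sY kappa -> 1 < c -> c < kappa ->
  gamma1 alpha sX sY 1 < A2 alpha sX sY c.
Proof.
move=> al sX0 sY0 [_ _ uniq] c1 ck; rewrite ltNge; apply/negP => hc.
have [u /andP[u1 uc] hu] := A2_near al sX0 sY0 c1.
have hx : A2 alpha sX sY c <= gamma1 alpha sX sY 1 <= A2 alpha sX sY u.
  by rewrite hc ltW.
have [z /andP[uz zc] hz] := A2_IVT al sY0 (lt_trans ltr01 u1) (ltW uc) hx.
have zk : z = kappa.
  by apply: uniq; [exact: lt_le_trans uz | exact/kappa_eqE].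
by move: zc; rewrite zk leNgt ck.
Qed.

(** Otherwise A2 would take the value gamma1(1) between c and a remote point,
    where it is smaller: a second solution of the equation. *)
Lemma A2_gt_kappa alpha sX sY kappa c : `|alpha| < 1 -> 0 < sX -> 0 < sY ->
  is_kappa alpha sX sY kappa -> kappa < c ->
  A2 alpha sX sY c < gamma1 alpha sX sY 1.
Proof.
move=> al sX0 sY0 [k1 _ uniq] kc; rewrite ltNge; apply/negP => hc.
have c1 : 1 < c := lt_trans k1 kc.
have [v cv hv] := A2_far al sX0 sY0 c1.
have hx : A2 alpha sX sY v <= gamma1 alpha sX sY 1 <= A2 alpha sX sY c.
  by rewrite hc ltW.
have [z /andP[cz zv] hz] := A2_IVT al sY0 (lt_trans ltr01 c1) (ltW cv) hx.
have zk : z = kappa.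
  by apply: uniq; [exact: lt_le_trans cz | exact/kappa_eqE].
by move: cz; rewrite zk leNgt kc.
Qed.

Lemma A2_kappa alpha sX sY kappa : `|alpha| < 1 -> 0 < sY ->
  is_kappa alpha sX sY kappa ->
  A2 alpha sX sY kappa = gamma1 alpha sX sY 1.
Proof. by move=> al sY0 [_ /(kappa_eqE _ _ al sY0)]. Qed.

Lemma rate_lt alpha sY c : `|alpha| < 1 -> 0 < sY -> 1 < c ->
  rate alpha sY c < rate alpha sY 1.
Proof.
move=> al sY0 c1; have g1 := gamma0_gt0 1 al sY0.
have lt_gamma0 : gamma0 alpha sY 1 < gamma0 alpha sY c.
  by rewrite [ltRHS]gamma0E// ltr_pMr// spread_gt1.
have gc : 0 < gamma0 alpha sY c := lt_trans g1 lt_gamma0.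
have p x : 0 < x -> 0 < 2 * x by move=> x0; rewrite pmulr_rgt0.
rewrite /rate ltf_pV2 ?posrE ?p//.
by rewrite ltr_pM2l.
Qed.

Lemma risk_scale_gt0 alpha : `|alpha| < 1 -> 0 < 4 / (1 - alpha ^+ 2).
Proof. by move=> al; rewrite divr_gt0// one_sub_sqr_gt0. Qed.

Lemma alpha_risk_plus0 alpha sX sY c :
  `|alpha| < 1 -> 0 < sX -> 0 < sY -> 0 < c ->
  alpha_risk alpha sX sY 0 (q_plus sY c) =
  (4 / (1 - alpha ^+ 2) * ((1 - A2 alpha sX sY c) / 2))%:E.
Proof.
move=> al sX0 sY0 c0; rewrite alpha_risk_plus// kern_mean0//; last first.
  by rewrite ltW// rate_gt0.
rewrite /A2 gamma1_shrink//; congr EFin; field.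
by rewrite gt_eqF// one_sub_sqr_gt0.
Qed.

Lemma A2_1 alpha sX sY : `|alpha| < 1 ->
  A2 alpha sX sY 1 = gamma1 alpha sX sY 1.
Proof. by move=> al; rewrite /A2 A1_1// mul1r addKr. Qed.

Lemma alpha_risk_plus_lt alpha sX sY c theta :
  `|alpha| < 1 -> 0 < sX -> 0 < sY -> 1 < c -> 0 < theta ->
  gamma1 alpha sX sY 1 <= A2 alpha sX sY c ->
  (alpha_risk alpha sX sY theta (q_plus sY c) <
   alpha_risk alpha sX sY theta (q_plus sY 1))%E.
Proof.
move=> al sX0 sY0 c1 th0 hA; have c0 : 0 < c := lt_trans ltr01 c1.
rewrite !alpha_risk_plus// A1_1// mul1r lte_fin ltr_pM2l ?risk_scale_gt0//.
rewrite ltrD2l ltrN2; apply: lt_kern_mean => //.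
- exact: A1_gt0.
- exact: rate_gt0.
- exact: rate_lt.
- by rewrite -!gamma1_shrink//; move: hA; rewrite /A2; lra.
Qed.

Lemma alpha_risk_plus0_lt alpha sX sY c :
  `|alpha| < 1 -> 0 < sX -> 0 < sY -> 0 < c ->
  (alpha_risk alpha sX sY 0 (q_plus sY c) <
   alpha_risk alpha sX sY 0 (q_plus sY 1))%E =
  (gamma1 alpha sX sY 1 < A2 alpha sX sY c).
Proof.
move=> al sX0 sY0 c0; rewrite !alpha_risk_plus0// A2_1// lte_fin.
rewrite ltr_pM2l ?risk_scale_gt0//.
by rewrite ltr_pM2r ?invr_gt0// ltrD2l ltrN2.
Qed.

Lemma alpha_risk_plus0_gt alpha sX sY c :
  `|alpha| < 1 -> 0 < sX -> 0 < sY -> 0 < c ->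
  (alpha_risk alpha sX sY 0 (q_plus sY 1) <
   alpha_risk alpha sX sY 0 (q_plus sY c))%E =
  (A2 alpha sX sY c < gamma1 alpha sX sY 1).
Proof.
move=> al sX0 sY0 c0; rewrite !alpha_risk_plus0// A2_1// lte_fin.
rewrite ltr_pM2l ?risk_scale_gt0//.
by rewrite ltr_pM2r ?invr_gt0// ltrD2l ltrN2.
Qed.

End domination.

Theorem theorem2 (R : realType) (alpha sX sY : R)
    (halpha : `|alpha| < 1) (hsX : 0 < sX) (hsY : 0 < sY) :
  (exists2 c : R, 1 < c & kappa_eq alpha sX sY c) /\
  (forall kappa : R, is_kappa alpha sX sY kappa ->
    (forall c : R, 1 <= c ->
      (dominates alpha sX sY [set theta | 0 <= theta] (q_plus sY c) (q_plus sY 1)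
       <-> 1 < c <= kappa)) /\
    (forall c : R, 1 < c <= kappa -> forall theta : R, 0 <= theta ->
      ((0 < theta \/ c < kappa) ->
        (alpha_risk alpha sX sY theta (q_plus sY c)
         < alpha_risk alpha sX sY theta (q_plus sY 1))%E) /\
      (alpha_risk alpha sX sY theta (q_plus sY c)
         = alpha_risk alpha sX sY theta (q_plus sY 1)
       <-> theta = 0 /\ c = kappa))).
Proof.
split; first exact: exists_kappa.
move=> kappa hk.
have A2k := A2_kappa halpha hsY hk.
have A2_ge c : 1 < c <= kappa -> gamma1 alpha sX sY 1 <= A2 alpha sX sY c.
  move=> /andP[c1]; rewrite le_eqVlt => /predU1P[->|ck]; first by rewrite A2k.
  exact/ltW/(A2_lt_kappa halpha hsX hsY hk).
have strict c theta : 1 < c <= kappa -> 0 <= theta -> 0 < theta \/ c < kappa ->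
    (alpha_risk alpha sX sY theta (q_plus sY c) <
     alpha_risk alpha sX sY theta (q_plus sY 1))%E.
  move=> ck; have /andP[c1 _] := ck.
  have pos : 0 < theta -> _ := fun h =>
    alpha_risk_plus_lt halpha hsX hsY c1 h (A2_ge c ck).
  rewrite le_eqVlt => /predU1P[<-|/pos//]; rewrite ltxx => -[//|ltck].
  rewrite (alpha_risk_plus0_lt halpha hsX hsY (lt_trans ltr01 c1)).
  exact: (A2_lt_kappa halpha hsX hsY hk).
have equal : alpha_risk alpha sX sY 0 (q_plus sY kappa) =
             alpha_risk alpha sX sY 0 (q_plus sY 1).
  have [k1 _ _] := hk; have k0 := lt_trans ltr01 k1.
  by rewrite !alpha_risk_plus0// A2k A2_1.
split=> [c c1|c ck theta th0]; last first.
  split; first exact: strict.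
  split=> [eq_risk|[-> ->]]; last exact: equal.
  have nstrict : ~ (0 < theta \/ c < kappa).
    by move=> /(strict _ _ ck th0); rewrite eq_risk ltxx.
  split; apply/eqP.
    by rewrite eq_le th0 andbT leNgt; apply/negP => h; apply: nstrict; left.
  have /andP[_ lek] := ck.
  by rewrite eq_le lek leNgt; apply/negP => h; apply: nstrict; right.
split=> [[dom [theta _ lt_risk]]|ck].
  have {}c1 : 1 < c.
    rewrite lt_neqAle c1 andbT; apply/eqP => c1E.
    by move: lt_risk; rewrite -c1E ltxx.
  rewrite c1 leNgt; apply/negP => kc.
  have := A2_gt_kappa halpha hsX hsY hk kc.
  rewrite -(alpha_risk_plus0_gt halpha hsX hsY (lt_trans ltr01 c1)) ltNge.
  by move=> /negP; apply; exact: dom 0 (lexx 0).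
split=> [theta /= th0|]; last first.
  by exists 1; [exact: ler01 | exact: strict ck ler01 (or_introl ltr01)].
have [pos|] := boolP ((0 < theta) || (c < kappa)).
  exact/ltW/(strict _ _ ck th0)/orP.
rewrite negb_or -!leNgt => /andP[th_le0 kc].
have -> : theta = 0 by apply/eqP; rewrite eq_le th0 th_le0.
have -> : c = kappa.
  by have /andP[_ ck'] := ck; apply/eqP; rewrite eq_le ck' kc.
by rewrite equal.
Qed.
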